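(* Let $\mathcal{A}$ be a WFA over $\Sigma$ and let $w\in\Sigma^\omega$. Put $\Delta=\Sigma^* w=\{uw : u\in\Sigma^*\}\subseteq\Sigma^\omega$. Suppose that $f_{\mathcal{A}}$ is continuous on the set $\Delta$, and suppose that there exists a continuous function $g:\Sigma^\omega\to\mathbb{R}$ such that $f_{\mathcal{A}}|_{\Delta}=g|_{\Delta}$. Then there is an average preserving WFA $\mathcal{B}$ over $\Sigma$ such that $f_{\mathcal{B}}=g$ (on all of $\Sigma^\omega$). Moreover, if $\mathcal{A}$ is left minimal then $\mathcal{B}$ can be obtained from $\mathcal{A}$ by changing the final distribution only.
   Context: $\Sigma$ is a nonempty finite alphabet; $\Sigma^*$ is the set of finite words (including the empty word), $\Sigma^\omega$ the set of infinite words with the prefix (Cantor) metric $d_C(w,w')=2^{-k}$, where $k$ is the length of the longest common prefix of $w\ne w'$ (and $d_C(w,w)=0$). $\mathrm{pref}_k(w)$ is the prefix of $w$ of length $k$. A weighted finite automaton (WFA) $\mathcal{A}$ over $\Sigma$ with $n\ge 0$ states consists of an initial distribution $I\in\mathbb{R}^{1\times n}$, a final distribution $F\in\mathbb{R}^{n\times 1}$, and weight (transition) matrices $A_a\in\mathbb{R}^{n\times n}$, $a\in\Sigma$. For $v=v_1\cdots v_k\in\Sigma^*$ put $A_v=A_{v_1}\cdots A_{v_k}$ (the identity matrix if $v$ is empty). The word function is $F_{\mathcal{A}}(v)=IA_vF$. The $\omega$-function $f_{\mathcal{A}}$ is the partial function on $\Sigma^\omega$ given by $f_{\mathcal{A}}(w)=\lim_{k\to\infty}F_{\mathcal{A}}(\mathrm{pref}_k(w))$,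 undefined where the limit does not exist. The hypothesis on $\Delta$ means in particular that $f_{\mathcal{A}}$ is defined at every point of $\Delta$; it may be undefined outside $\Delta$, and continuity on $\Delta$ refers to the restriction to $\Delta$. $\mathcal{A}$ is average preserving (ap) if $\sum_{a\in\Sigma}A_aF=|\Sigma|F$. $\mathcal{A}$ is left minimal if $\dim\langle IA_u : u\in\Sigma^*\rangle=n$. *)

(* Defs.v *)
From HB Require Import structures.
From mathcomp Require Import all_boot all_order all_algebra.
From mathcomp Require Import all_classical all_reals all_analysis.

Set Implicit Arguments.
Unset Strict Implicit.
Unset Printing Implicit Defensive.

Import Order.TTheory GRing.Theory Num.Theory.
Import numFieldNormedType.Exports.

Local Open Scope classical_set_scope.
Local Open Scope ring_scope.

(* R is a phantom parameter: it is the type in which the Cantor metric takes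
   its values, and lets the metric structure below be inferred. *)
Definition omega_word (R : realType) (Sigma : finType) : Type := nat -> Sigma.

HB.instance Definition _ (R : realType) (Sigma : finType) :=
  Choice.copy (omega_word R Sigma) (nat -> Sigma).

Section CantorMetric.
Context {R : realType} {Sigma : finType}.
Implicit Types x y z : omega_word R Sigma.

(* The least index at which x and y differ is the length of their longest
   common prefix. *)
Definition cantor_dist x y : R :=
  match pselect (exists k, x k != y k) with
  | left neq_xy => 2^-1 ^+ ex_minn neq_xy
  | right _ => 0
  end.

Lemma cantor_distxx x : cantor_dist x x = 0.
Proof.
rewrite /cantor_dist; case: pselect => // h.
by exfalso; case: h => k /eqP.
Qed.

Lemma cantor_distE x y : x <> y ->
  exists2 k, cantor_dist x y = 2^-1 ^+ k &
    x k != y k /\ forall i, (i < k)%N -> x i = y i.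
Proof.
move=> neq; rewrite /cantor_dist; case: pselect => [h|nh].
  case: ex_minnP => k xk kmin; exists k => //; split=> // i ik.
  by apply/eqP; apply: contraTT ik => /kmin; rewrite -leqNgt.
exfalso; apply: neq; apply/funext => k; apply/eqP/negPn/negP => xk.
by apply: nh; exists k.
Qed.

Lemma cantor_dist_le x y k : (forall i, (i < k)%N -> x i = y i) ->
  cantor_dist x y <= 2^-1 ^+ k.
Proof.
have [->|neq] := EM (x = y); first by rewrite cantor_distxx exprn_ge0.
have [m -> [xm _]] := cantor_distE neq => kxy.
apply: ler_wiXn2l; rewrite ?invr_ge0 ?invf_le1 ?ler1n //.
by rewrite leqNgt; apply: contra xm => /kxy ->.
Qed.

Lemma cantor_dist_ge0 x y : 0 <= cantor_dist x y.
Proof. by rewrite /cantor_dist; case: pselect => // *; rewrite exprn_ge0. Qed.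

Lemma cantor_dist_eq0 x y : cantor_dist x y = 0 -> x = y.
Proof.
move=> d0; apply: contrapT => /cantor_distE[k dk _].
by move/eqP: d0; rewrite dk expf_eq0 invr_eq0 pnatr_eq0 andbF.
Qed.

Lemma cantor_distC x y : cantor_dist x y = cantor_dist y x.
Proof.
have [->//|neq] := EM (x = y).
have [k dk [_ xy]] := cantor_distE neq.
have [m dm [_ yx]] := cantor_distE (nesym neq).
apply/le_anti/andP; split.
  by rewrite dm; apply: cantor_dist_le => i /yx.
by rewrite dk; apply: cantor_dist_le => i /xy.
Qed.

Lemma cantor_dist_triangle y x z :
  cantor_dist x z <= cantor_dist x y + cantor_dist y z.
Proof.
have [->|/cantor_distE[k dk [_ xy]]] := EM (x = y).
  by rewrite cantor_distxx add0r.
have [<-|/cantor_distE[m dm [_ yz]]] := EM (y = z).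
  by rewrite cantor_distxx addr0.
have [km|/ltnW mk] := leqP k m.
  apply: (@le_trans _ _ (cantor_dist x y)); last by rewrite lerDl cantor_dist_ge0.
  by rewrite dk; apply: cantor_dist_le => i ik; rewrite xy ?yz ?(leq_trans ik).
apply: (@le_trans _ _ (cantor_dist y z)); last by rewrite lerDr cantor_dist_ge0.
by rewrite dm; apply: cantor_dist_le => i im; rewrite xy ?yz ?(leq_trans im).
Qed.

HB.instance Definition _ := isMetric.Build R (omega_word R Sigma)
  cantor_distxx cantor_dist_eq0 cantor_distC cantor_dist_triangle.

Definition pref (k : nat) (w : omega_word R Sigma) : seq Sigma := mkseq w k.

Definition omega_cat (u : seq Sigma) (w : omega_word R Sigma) :
    omega_word R Sigma :=
  fun i => if (i < size u)%N then nth (w 0%N) u i else w (i - size u)%N.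

Definition left_translates (w : omega_word R Sigma) :
    set (omega_word R Sigma) :=
  [set omega_cat u w | u in [set: seq Sigma]].

End CantorMetric.

Record wfa (R : realType) (Sigma : finType) (n : nat) := Wfa {
  initial : 'rV[R]_n;
  weight : Sigma -> 'M[R]_n;
  final : 'cV[R]_n
}.

Section WFA.
Context {R : realType} {Sigma : finType} {n : nat}.
Implicit Type A : wfa R Sigma n.

Definition word_weight A (v : seq Sigma) : 'M[R]_n :=
  \big[mulmx/1%:M]_(a <- v) weight A a.

(* A 1 x 1 matrix is identified with its entry. *)
Definition word_fun A (v : seq Sigma) : R :=
  (initial A *m word_weight A v *m final A) 0 0.

(* The partial function f_A is the pair of its domain [omega_dom A] and of the
   total function [omega_fun A], meaningful on that domain only. *)
Definition omega_dom A : set (omega_word R Sigma) :=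
  [set w | cvgn (fun k => word_fun A (pref k w))].

Definition omega_fun A (w : omega_word R Sigma) : R :=
  limn (fun k => word_fun A (pref k w)).

Definition average_preserving A : Prop :=
  \sum_(a : Sigma) weight A a *m final A = #|Sigma|%:R *: final A.

Definition set_final A (F : 'cV[R]_n) : wfa R Sigma n :=
  Wfa (initial A) (weight A) F.

End WFA.

(* U is the linear span of the possibly infinite set S. *)
Definition is_span (R : realType) (V : vectType R) (S : set V)
    (U : {vspace V}) : Prop :=
  forall v : V, v \in U <->
    exists2 s : seq V, (forall x, x \in s -> S x) & v \in span s.

Definition left_minimal (R : realType) (Sigma : finType) (n : nat)
    (A : wfa R Sigma n) : Prop :=
  exists2 U : {vspace 'rV[R]_n},
    is_span [set initial A *m word_weight A u | u in [set: seq Sigma]] U &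
    \dim U = n.

(* Main.v *)
Require Import Defs.
From mathcomp Require Import all_boot all_order all_algebra.
From mathcomp Require Import all_classical all_reals all_analysis.

Set Implicit Arguments.
Unset Strict Implicit.
Unset Printing Implicit Defensive.

Import Order.TTheory GRing.Theory Num.Theory.
Import numFieldNormedType.Exports.
Local Open Scope classical_set_scope.
Local Open Scope ring_scope.

(** If [A] is left minimal, the existence of f_A(uw) for all u makes the columns
    A_(pref_k w) F converge to a column c with I A_u c = g(uw) for all u. Put
    M = |Sigma|^-1 sum_a A_a. Then I A_u M^m c is the mean of g(uvw) over the
    words v of length m, and these means form a Cauchy sequence because g is
    uniformly continuous on the compact space Sigma^omega. By left minimality
    M^m c converges to a column F', which is fixed by M, so that the automaton
    with final column F' is average preserving. Its value I A_u F' is a limit of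
    means of g over points of the cylinder of u, hence is close to g on that
    cylinder when u is long, which gives f_B = g. The general case reduces to
    this one by replacing A by a left minimal automaton with the same word
    function. *)

(** * Uniform continuity on the Cantor space *)

Section CantorSpace.
Variables (R : realType) (Sigma : finType).
Implicit Types (x y : omega_word R Sigma) (u v : seq Sigma).

Lemma continuous_cantor_ex (g : omega_word R Sigma -> R) x (e : R) :
    continuous g -> 0 < e ->
  exists k, forall y, (forall i, (i < k)%N -> x i = y i) -> `|g x - g y| < e.
Proof.
move=> g_cont e_gt0; have /cvgrPdist_lt/(_ e e_gt0) := g_cont x.
case/nbhs_ballP => d /= d_gt0 xd.
have [k kd] : exists k, (2^-1 : R) ^+ k < d.
  have /cvgrPdist_lt/(_ d d_gt0) : (fun k => (2^-1 : R) ^+ k) @ \oo --> (0 : R).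
    by apply: cvg_expr; rewrite ger0_norm ?invr_ge0// invf_lt1 ?ltr1n.
  case=> k _ /(_ k (leqnn k)) /=; rewrite sub0r normrN ger0_norm ?exprn_ge0//.
  by exists k.
exists k => y xy; apply: xd; rewrite ballEmdist /=.
exact: le_lt_trans (cantor_dist_le xy) kd.
Qed.

(* A word is good if some extension length controls the oscillation of g on its
   cylinder; a word all of whose one-letter extensions are good is good, so if
   the empty word were bad there would be an infinite branch of bad words,
   contradicting continuity at that branch. *)
Lemma uniform_continuous_cantor (g : omega_word R Sigma -> R) (e : R) :
    continuous g -> 0 < e ->
  exists k, forall x y, (forall i, (i < k)%N -> x i = y i) -> `|g x - g y| <= e.
Proof.
move=> g_cont e_gt0; apply: contrapT => not_unif.
pose good u := exists k, forall x y, pref (size u) x = u ->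
  (forall i, (i < k)%N -> x i = y i) -> `|g x - g y| <= e.
(* A dummy value for [next] at good words; without letters there would be no infinite words. *)
have [a0 _] : exists a : Sigma, True.
  apply: contrapT => empty; apply: not_unif; exists 0%N => x.
  by case: empty; exists (x 0%N).
have bad_rcons u : exists a, ~ good u -> ~ good (rcons u a).
  have [good_u|bad_u] := EM (good u); first by exists a0.
  apply: contrapT => /forallNP good_ua; apply: bad_u.
  have /choice[K Kgood] : forall a, good (rcons u a).
    by move=> a; apply: contrapT => bad_ua; apply: (good_ua a).
  (* The alphabet being finite, one length serves all letters; the letter that follows [u] in [x] is
     [x (size u)]. *)
  exists (\max_a K a) => x y xu xy.
  apply: (Kgood (x (size u))) => [|i iK].
    by rewrite size_rcons /pref mkseqS; congr rcons.
  by apply/xy/(leq_trans iK)/leq_bigmax.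
have /choice[next next_bad] := bad_rcons.
pose branch k := iter k (fun u => rcons u (next u)) [::].
pose x : omega_word R Sigma := fun k => next (branch k).
have branchE k : pref k x = branch k.
  by elim: k => //= k IHk; rewrite /pref mkseqS -/(pref k x) IHk.
have branch_bad k : ~ good (branch k).
  elim: k => [[k kgood]|k]; last exact: next_bad.
  by apply: not_unif; exists k => y z; apply: kgood.
have [k kx] := continuous_cantor_ex x g_cont (divr_gt0 e_gt0 (ltr0Sn R 1)).
apply: (branch_bad k); exists k => y z; rewrite -branchE size_mkseq => yx yz.
have xy i : (i < k)%N -> x i = y i.
  by move=> ik; rewrite -(nth_mkseq (x 0%N) x ik) -[mkseq x k]yx nth_mkseq.
have /ltW xy2 := kx y xy.
have /ltW xz2 : `|g x - g z| < e / 2 by apply: kx => i ik; rewrite xy// yz.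
rewrite (splitr e) -(subrKA (g x)) (le_trans (ler_normD _ _))//.
by rewrite lerD// distrC.
Qed.

End CantorSpace.

(** * Means over the extensions of a word *)

Section Averages.
Variables (R : realType) (Sigma : finType).
Hypothesis Sigma_gt0 : (0 < #|Sigma|)%N.
Implicit Types (h : seq Sigma -> R) (u v : seq Sigma).

Lemma mean_dist_le (f : Sigma -> R) (c e : R) :
  (forall a, `|f a - c| <= e) -> `|#|Sigma|%:R^-1 * \sum_a f a - c| <= e.
Proof.
move=> fe; have N_gt0 : 0 < #|Sigma|%:R :> R by rewrite ltr0n.
have -> : #|Sigma|%:R^-1 * \sum_a f a - c =
          #|Sigma|%:R^-1 * \sum_a (f a - c).
  rewrite big_split /= sumr_const -[#|_|]/#|Sigma| mulrDr; congr (_ + _).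
  by rewrite mulNrn -(mulr_natl c) mulrN mulKf ?gt_eqF.
rewrite normrM ger0_norm ?invr_ge0 ?ler0n// ler_pdivrMl//.
apply: le_trans (ler_norm_sum _ _ _) _.
apply: le_trans (ler_sum _ (fun a _ => fe a)) _.
by rewrite sumr_const mulr_natl.
Qed.

(** The mean of [h (u ++ v)] over all words [v] of length [m], taken letter by letter so that one
    step matches one multiplication by the mean matrix. *)
Fixpoint word_avg h (m : nat) u : R :=
  if m is m'.+1 then #|Sigma|%:R^-1 * \sum_a word_avg h m' (rcons u a) else h u.

Lemma word_avg_dist_le h c e m u :
  (forall v, `|h (u ++ v) - c| <= e) -> `|word_avg h m u - c| <= e.
Proof.
elim: m u => [|m IHm] u hu /=; first by rewrite -[u]cats0.
by apply: mean_dist_le => a; apply: IHm => v; rewrite cat_rcons.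
Qed.

(** Both means share their first [m] letters; after these every word has length at least [k], where
    further letters change [h] by at most [e]. *)
Lemma word_avg_cauchy h e k m j u :
    (forall u v, (k <= size u)%N -> `|h (u ++ v) - h u| <= e) ->
    (k <= size u + m)%N ->
  `|word_avg h (m + j) u - word_avg h m u| <= e.
Proof.
move=> he; elim: m u => [|m IHm] u ku /=.
  by apply: word_avg_dist_le => v; apply: he; rewrite addn0 in ku.
rewrite -mulrBr -sumrB -[X in `|X|]subr0; apply: mean_dist_le => a.
by rewrite subr0 IHm// size_rcons addSnnS.
Qed.

End Averages.

(** * Prefixes of concatenations *)

Section OmegaWords.
Variables (R : realType) (Sigma : finType).
Implicit Types (w x : omega_word R Sigma) (u v : seq Sigma).

Lemma omega_cat_prefix u v w i :
  (i < size u)%N -> omega_cat (u ++ v) w i = omega_cat u w i.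
Proof. by move=> iu; rewrite /omega_cat size_cat ltn_addr// iu nth_cat iu. Qed.

Lemma omega_cat_pref k x w i : (i < k)%N -> omega_cat (pref k x) w i = x i.
Proof. by move=> ik; rewrite /omega_cat size_mkseq ik nth_mkseq. Qed.

Lemma pref_omega_cat u w k : pref (k + size u) (omega_cat u w) = u ++ pref k w.
Proof.
rewrite /pref /mkseq addnC iotaD map_cat add0n; congr (_ ++ _).
  apply: (@eq_from_nth _ (w 0%N)) => [|i]; rewrite size_map size_iota// => iu.
  by rewrite (nth_map 0%N) ?size_iota// nth_iota// /omega_cat iu.
rewrite -[X in iota X]addn0 iotaDl -map_comp; apply: eq_map => i /=.
by rewrite /omega_cat ltnNge leq_addr/= addKn.
Qed.

End OmegaWords.

(** * Entrywise limits of matrices *)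

Section MatrixLimits.
Variable R : realType.

Lemma cvgn_sum (I : Type) (r : seq I) (u : I -> nat -> R) (l : I -> R) :
    (forall i, u i @ \oo --> l i) ->
  (fun k => \sum_(i <- r) u i k) @ \oo --> \sum_(i <- r) l i.
Proof.
move=> ul; elim: r => [|i r IHr].
  by under eq_fun do rewrite big_nil; rewrite big_nil; apply: cvg_cst.
by under eq_fun do rewrite big_cons; rewrite big_cons; apply: cvgD.
Qed.

Lemma cvgn_mulmx (p n q : nat) (M : 'M[R]_(p, n)) (c : nat -> 'M[R]_(n, q))
    (l : 'M[R]_(n, q)) :
    (forall i j, (fun k => c k i j) @ \oo --> l i j) ->
  forall i j, (fun k => (M *m c k) i j) @ \oo --> (M *m l) i j.
Proof.
move=> cl i j; under eq_fun do rewrite mxE; rewrite mxE.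
by apply: cvgn_sum => i'; apply: cvgMr.
Qed.

End MatrixLimits.

(** * Word weights and left minimization *)

Section Wfa.
Variables (R : realType) (Sigma : finType).
Implicit Types (u v : seq Sigma).

Lemma word_weight_nil n (A : wfa R Sigma n) : word_weight A [::] = 1%:M.
Proof. exact: big_nil. Qed.

Lemma word_weight_cons n (A : wfa R Sigma n) a u :
  word_weight A (a :: u) = weight A a *m word_weight A u.
Proof. exact: big_cons. Qed.

Lemma word_weight_cat n (A : wfa R Sigma n) u v :
  word_weight A (u ++ v) = word_weight A u *m word_weight A v.
Proof.
elim: u => [|a u IHu]; first by rewrite word_weight_nil mul1mx.
by rewrite cat_cons !word_weight_cons IHu mulmxA.
Qed.

Lemma word_weight_rcons n (A : wfa R Sigma n) u a :
  word_weight A (rcons u a) = word_weight A u *m weight A a.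
Proof.
by rewrite -cats1 word_weight_cat word_weight_cons word_weight_nil mulmx1.
Qed.

(** By a dimension count the vectors [initial A *m word_weight A u] span all rows. *)
Lemma left_minimal_ind n (A : wfa R Sigma n) (P : 'rV[R]_n -> Prop) :
    left_minimal A -> P 0 -> (forall a x y, P x -> P y -> P (a *: x + y)) ->
    (forall u, P (initial A *m word_weight A u)) ->
  forall x, P x.
Proof.
move=> [U spanU dimU] P0 Plin PA x.
have UT : U = fullv.
  by apply/eqP; rewrite eqEdim subvf dimvf dim_matrix mul1r dimU /=.
have /spanU[s sA xs] : x \in U by rewrite UT memvf.
rewrite (coord_span (X := in_tuple s) xs).
apply: (big_rec P) => // i y _ Py; apply: Plin => //.
have [u _ <-] : [set initial A *m word_weight A u | u in setT] s`_i.
  by apply/sA/mem_nth.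
exact: PA.
Qed.

(* The row space of [X] below is the span of the vectors [I A_u]; being stable
   under every [A_a], it carries a restriction of the automaton. *)
Lemma left_minimization n (A : wfa R Sigma n) :
  exists m (B : wfa R Sigma m), left_minimal B /\ word_fun B =1 word_fun A.
Proof.
pose reach u := initial A *m word_weight A u.
pose X us := \matrix_(i < size us) reach (nth [::] us i).
pose attained r := `[< exists us, \rank (X us) = r >].
have attained0 : exists r, attained r.
  by exists (\rank (X [::])); apply/asboolP; exists [::].
have attained_le r : attained r -> (r <= n)%N.
  by move=> /asboolP[us <-]; apply: rank_leq_col.
(* A finite family of reachable vectors of maximal rank: adding [reach u] cannot enlarge its row
   space. *)
case: (ex_maxnP attained0 attained_le) => r /asboolP[us rank_us] r_max.
have reachX u : (reach u <= X us)%MS.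
  have usX : (X us <= X (u :: us))%MS.
    apply/row_subP => i; rewrite rowK.
    by have := row_sub (lift ord0 i) (X (u :: us)); rewrite rowK.
  have uX : (reach u <= X (u :: us))%MS.
    by have := row_sub ord0 (X (u :: us)); rewrite rowK.
  apply: (submx_trans uX); rewrite -(mxrank_leqif_sup usX) eqn_leq.
  by rewrite mxrankS//= rank_us r_max//; apply/asboolP; exists (u :: us).
set E := row_base (X us).
have reachE u : (reach u <= E)%MS by rewrite eq_row_base.
have stabE a : (E *m weight A a <= E)%MS.
  have EX : (E *m weight A a <= X us *m weight A a)%MS.
    by apply: submxMr; rewrite eq_row_base.
  apply: submx_trans EX _; apply/row_subP => i.
  by rewrite row_mul rowK /reach -mulmxA -word_weight_rcons reachE.
(* On the row space of [E], multiplication by [pinvmx E] gives coordinates in the basis [E]. *)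
pose B := Wfa (initial A *m pinvmx E) (fun a => E *m weight A a *m pinvmx E)
  (E *m final A).
have BE u : initial B *m word_weight B u *m E = reach u.
  elim/last_ind: u => [|u a IHu].
    rewrite /reach !word_weight_nil !mulmx1 mulmxKpV//.
    by have := reachE [::]; rewrite /reach word_weight_nil mulmx1.
  rewrite word_weight_rcons mulmxA -(mulmxA _ _ E) mulmxKpV//.
  by rewrite mulmxA IHu /reach word_weight_rcons !mulmxA.
exists (\rank (X us)), B; split; last first.
  by move=> u; rewrite /word_fun mulmxA BE.
exists fullv; last by rewrite dimvf dim_matrix mul1r.
move=> x; split=> [_|_]; last exact: memvf.
exists [seq initial B *m word_weight B u | u <- us].
  by move=> _ /mapP[u _ ->]; exists u.
have /submxP[c xE] : (x *m E <= X us)%MS.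
  by rewrite -(eq_row_base (X us)) submxMl.
(* The rows of [E] are independent, so the equality can be checked after multiplication by [E]. *)
have -> : x = \sum_i c 0 i *: (initial B *m word_weight B (nth [::] us i)).
  apply: (row_free_inj (row_base_free (X us))); rewrite /= xE mulmx_sum_row.
  rewrite mulmx_suml; apply: eq_bigr => i _.
  by rewrite rowK -scalemxAl BE.
apply: memv_suml => i _; apply/memvZ/memv_span/map_f.
exact: mem_nth.
Qed.

End Wfa.

(** * The new final column *)

Section AveragePreserving.
Variables (R : realType) (Sigma : finType) (n : nat) (A : wfa R Sigma n).
Hypotheses (Sigma_gt0 : (0 < #|Sigma|)%N) (A_min : left_minimal A).

(** The rows [x] for which [x *m c k] converges form a subspace containing every reachable vector,
    hence all rows; the unit rows give the entries. *)
Lemma left_minimal_cvg (c : nat -> 'cV[R]_n) :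
    (forall u, cvgn (fun k => (initial A *m word_weight A u *m c k) 0 0)) ->
  exists l : 'cV[R]_n, forall i j, (fun k => c k i j) @ \oo --> l i j.
Proof.
move=> Ac_cvg; pose P (x : 'rV[R]_n) := cvgn (fun k => (x *m c k) 0 0).
have P0 : P 0.
  by rewrite /P; under eq_fun do rewrite mul0mx mxE; apply: is_cvg_cst.
have Plin a y z : P y -> P z -> P (a *: y + z).
  move=> yc zc; rewrite /P.
  under eq_fun do rewrite mulmxDl -scalemxAl mxE [X in X + _]mxE.
  by apply: is_cvgD => //; apply: is_cvgMr.
have xc_cvg x : P x := left_minimal_ind A_min P0 Plin Ac_cvg x.
exists (\col_i limn (fun k => c k i 0)) => i j; rewrite ord1 mxE.
have -> : (fun k => c k i 0) =
          (fun k => ((delta_mx 0 i : 'rV[R]_n) *m c k) 0 0).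
  by apply/funext => k; rewrite -rowE mxE.
exact: xc_cvg.
Qed.

Variables (w : omega_word R Sigma) (g : omega_word R Sigma -> R).
Hypotheses (fA_def : left_translates w `<=` omega_dom A) (g_cont : continuous g)
  (fA_eq_g : forall x, left_translates w x -> omega_fun A x = g x).

Lemma translate_column : exists c : 'cV[R]_n,
  forall u, (initial A *m word_weight A u *m c) 0 0 = g (omega_cat u w).
Proof.
pose c k := word_weight A (pref k w) *m final A.
have Ac_cvg u :
  (fun k => (initial A *m word_weight A u *m c k) 0 0) @ \oo -->
    g (omega_cat u w).
  have uw : left_translates w (omega_cat u w) by exists u.
  pose f k := word_fun A (pref k (omega_cat u w)).
  (* Dropping the first [size u] prefixes keeps the limit and leaves only prefixes
     [u ++ pref k w]. *)
  have <- : (fun k => f (k + size u)%N) =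
            (fun k => (initial A *m word_weight A u *m c k) 0 0).
    by apply/funext => k; rewrite /f /word_fun pref_omega_cat word_weight_cat
      !mulmxA.
  by rewrite -(fA_eq_g uw) (cvg_shiftn (size u) f); apply: fA_def.
have [l cl] : exists l : 'cV[R]_n,
    forall i j, (fun k => c k i j) @ \oo --> l i j.
  by apply: left_minimal_cvg => u; apply: cvgP (Ac_cvg u).
exists l => u.
have /cvg_lim <- // := Ac_cvg u.
by apply/esym/cvg_lim => //; apply: cvgn_mulmx.
Qed.

Let mean_weight : 'M[R]_n := #|Sigma|%:R^-1 *: \sum_a weight A a.

Lemma word_avg_translate (c : 'cV[R]_n) m u :
    (forall v, (initial A *m word_weight A v *m c) 0 0 = g (omega_cat v w)) ->
  word_avg (fun v => g (omega_cat v w)) m u =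
    (initial A *m word_weight A u *m iter m (mulmx mean_weight) c) 0 0.
Proof.
move=> Ac; elim: m u => [|m IHm] u //=.
rewrite mulmxA -scalemxAr -scalemxAl mxE; congr (_ * _).
rewrite mulmx_sumr mulmx_suml summxE; apply: eq_bigr => a _.
by rewrite IHm word_weight_rcons !mulmxA.
Qed.

Lemma average_preserving_final : exists F : 'cV[R]_n,
  [/\ average_preserving (set_final A F),
      omega_dom (set_final A F) = setT
    & omega_fun (set_final A F) =1 g].
Proof.
have [c Ac] := translate_column.
pose h u := g (omega_cat u w).
have hE m u := word_avg_translate m u Ac; rewrite -/h in hE.
have h_unif (e : R) : 0 < e -> exists k, forall u v,
    (k <= size u)%N -> `|h (u ++ v) - h u| <= e.
  move=> /(uniform_continuous_cantor g_cont)[k kg]; exists k => u v ku.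
  by apply: kg => i ik; apply/omega_cat_prefix/(leq_trans ik).
have [F cF] : exists F : 'cV[R]_n, forall i j,
    (fun m => iter m (mulmx mean_weight) c i j) @ \oo --> F i j.
  apply: left_minimal_cvg => u; under eq_fun do rewrite -hE.
  apply/cauchy_cvgP/cauchy_exP => e e_gt0.
  have [k kh] := h_unif (e / 2) (divr_gt0 e_gt0 (ltr0Sn R 1)).
  exists (word_avg h k u); exists k => // m /= km.
  rewrite /ball /= distrC -(subnKC km).
  apply: le_lt_trans (word_avg_cauchy Sigma_gt0 _ kh _) _.
    exact: leq_addl.
  by rewrite ltr_pdivrMr// mulr_natr mulr2n ltrDl.
have AF u : word_avg h ^~ u @ \oo --> word_fun (set_final A F) u.
  by under eq_fun do rewrite hE; apply: cvgn_mulmx.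
have BF x : (fun k => word_fun (set_final A F) (pref k x)) @ \oo --> g x.
  apply/cvgrPdist_le => e e_gt0.
  have e2_gt0 : 0 < e / 2 by rewrite divr_gt0.
  have [k kg] := uniform_continuous_cantor g_cont e2_gt0.
  have [k' kh] := h_unif _ e2_gt0.
  exists (maxn k k') => // m /=; rewrite geq_max => /andP[km k'm].
  (* Compare both with [g] at [omega_cat (pref m x) w]: this point shares [m] letters with [x], and
     all means over extensions of [pref m x], hence their limit, are within [e / 2] of its value. *)
  rewrite (splitr e) -(subrKA (h (pref m x))) (le_trans (ler_normD _ _))//.
  apply: lerD.
    by apply: kg => i ik; rewrite omega_cat_pref// (leq_trans ik).
  have hAF : (fun j => `|h (pref m x) - word_avg h j (pref m x)|) @ \oo -->
      `|h (pref m x) - word_fun (set_final A F) (pref m x)|.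
    by apply: cvg_norm; apply: cvgB; [exact: cvg_cst|exact: AF].
  have <- := cvg_lim (@Rhausdorff R) hAF; apply: (limr_le (cvgP _ hAF)).
  exists 0%N => // j _ /=; rewrite distrC; apply: word_avg_dist_le => // v.
  by apply: kh; rewrite size_mkseq.
exists F; split.
(* The shifted iterates tend both to [F] and to [mean_weight *m F]. *)
- have MF : mean_weight *m F = F.
    apply/matrixP => i j; have /cvg_lim <- // := cF i j.
    apply/esym/cvg_lim => //; rewrite -cvg_shiftS /=.
    exact: (cvgn_mulmx cF).
  rewrite /average_preserving /= -[in RHS]MF -scalemxAl scalerA mulfV.
    by rewrite scale1r mulmx_suml.
  by rewrite pnatr_eq0 -lt0n.
- by apply/seteqP; split=> // x _; apply: cvgP (BF x).
- by move=> x; apply: cvg_lim (BF x).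
Qed.

End AveragePreserving.

Theorem theorem18 (R : realType) (Sigma : finType) (Sigma_gt0 : (0 < #|Sigma|)%N)
    (n : nat) (A : wfa R Sigma n) (w : omega_word R Sigma)
    (g : omega_word R Sigma -> R)
    (fA_def : left_translates w `<=` omega_dom A)
    (fA_cont : {within left_translates w, continuous (omega_fun A)})
    (g_cont : continuous g)
    (fA_eq_g : forall x, left_translates w x -> omega_fun A x = g x) :
  (exists (m : nat) (B : wfa R Sigma m),
     [/\ average_preserving B, omega_dom B = setT & omega_fun B =1 g]) /\
  (left_minimal A ->
   exists F : 'cV[R]_n,
     [/\ average_preserving (set_final A F),
         omega_dom (set_final A F) = setT
       & omega_fun (set_final A F) =1 g]).
Proof.
split=> [|A_min]; last first.
  exact: (average_preserving_final Sigma_gt0 A_min fA_def g_cont fA_eq_g).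
have [m [B [B_min /funext BA]]] := left_minimization A.
have domBA : omega_dom B = omega_dom A by rewrite /omega_dom BA.
have funBA : omega_fun B = omega_fun A by rewrite /omega_fun BA.
rewrite -domBA in fA_def; rewrite -funBA in fA_eq_g.
have [F BF] := average_preserving_final Sigma_gt0 B_min fA_def g_cont fA_eq_g.
by exists m, (set_final B F).
Qed.
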